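(* Let $(X,d)$ be a cocompact proper metric space that is $M$-scale connected for some $M>0$. If $\operatorname{asdim}_{AN}(X)$ is finite, then $\operatorname{asdim}_{AN}(X)=\dim(\nu_L(X))$.
   Context: All metric spaces are equipped with a base point $x_0$; the norm of a point is $|x|=d(x,x_0)$. A metric space is proper if its closed bounded subsets are compact. $X$ is cocompact if there is a compact subset $K\subset X$ such that for every $x\in X$ there is an isometry $\gamma$ of $X$ with $x\in\gamma(K)$. $X$ is $M$-scale connected if any two points $x,y\in X$ can be joined by a chain $x_1=x,\ldots,x_k=y$ with $d(x_i,x_{i+1})\le M$ for all $i\le k-1$. The asymptotic Assouad-Nagata dimension $\operatorname{asdim}_{AN}(X)$ is the smallest integer $n\ge 0$ for which there are $C>0$ and $r_0>0$ such that for every $r\ge r_0$ there is a cover of $X$ by sets of diameter at most $C r$ which is a union of $n+1$ families $\mathcal{U}_1,\dots,\mathcal{U}_{n+1}$, each $r$-disjoint (distinct members of the same family are at distance at least $r$). Let $\mathbb{R}_+=[0,\infty)$. A continuous function $s\colon\mathbb{R}_+\to\mathbb{R}_+$ is asymptotically sublinear if for each non-constant linear function $f\colon\mathbb{R}_+\to\mathbb{R}_+$ there is $M'$ such that $s(r)\le f(r)+M'$ for all $r$. A continuous function $f\colon (X,d_X)\to (Y,d_Y)$ is Higson sublinear if for each asymptotically sublinear $s$, the conditions $x_n,y_n\to\infty$ (i.e. $|x_n|,|y_n|\to\infty$) and $d_X(x_n,y_n)\le s(|x_n|)$ for all $n\ge 1$ imply $d_Y(f(x_n),f(y_n))\to 0$.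 The Higson sublinear compactification $h_L(X)$ is the compactification of $X$ (compact Hausdorff, containing $X$ as a dense subspace) characterized by: a bounded continuous function $X\to\mathbb{R}$ extends continuously over $h_L(X)$ if and only if it is Higson sublinear. For $X$ proper, the sublinear Higson corona is $\nu_L(X)=h_L(X)\setminus X$. $\dim$ is covering dimension. *)

(* Defs.v *)
From HB Require Import structures.
From mathcomp Require Import all_boot all_order all_algebra.
From mathcomp Require Import all_classical all_reals all_analysis.
Import numFieldNormedType.Exports.

Set Implicit Arguments.
Unset Strict Implicit.
Unset Printing Implicit Defensive.

Import Order.TTheory GRing.Theory Num.Theory.
Local Open Scope classical_set_scope.
Local Open Scope ring_scope.
Local Open Scope card_scope.

(* The least element of a set of naturals; [None], read as infinity, for the
   empty set. *)
Definition least (A : set nat) : option nat :=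
  if pselect (exists n, `[< A n >]) is left exA then Some (ex_minn exA)
  else None.

Lemma leastP (A : set nat) (n : nat) :
  least A = Some n <-> A n /\ forall m, A m -> (n <= m)%N.
Proof.
rewrite /least; case: pselect => [exA|nexA].
  case: ex_minnP => k /asboolP Ak kmin; split.
    by move=> [<-]; split=> // m Am; apply: kmin; apply/asboolP.
  case=> An nmin; congr Some; apply/eqP; rewrite eqn_leq nmin // andbT.
  by apply: kmin; apply/asboolP.
by split=> // -[An _]; case: nexA; exists n; apply/asboolP.
Qed.

Lemma leastPN (A : set nat) : least A = None <-> forall n, ~ A n.
Proof.
rewrite /least; case: pselect => [exA|nexA]; split=> //.
  by move=> nA; have [n /asboolP An] := exA; case: (nA n An).
by move=> _ n An; apply: nexA; exists n; apply/asboolP.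
Qed.

Section MetricNotions.
Context {R : realType}.
Implicit Types X Y : metricType R.

Definition diam_le X (A : set X) (D : R) : Prop :=
  forall x y, A x -> A y -> mdist x y <= D.

Definition proper_space X : Prop :=
  forall A : set X, closed A -> (exists D, diam_le A D) -> compact A.

Definition isometry_of X (g : X -> X) : Prop :=
  bijective g /\ forall x y, mdist (g x) (g y) = mdist x y.

Definition cocompact X : Prop :=
  exists2 C : set X, compact C &
    forall x, exists2 g : X -> X, isometry_of g & (g @` C) x.

Definition scale_connected X (M : R) : Prop :=
  forall x y : X, exists2 p : seq X,
    path (fun u v => mdist u v <= M) x p & last x p = y.

Definition scale_disjoint X (r : R) (U : set (set X)) : Prop :=
  forall A B, U A -> U B -> A <> B -> forall x y, A x -> B y -> r <= mdist x y.

Definition asdimAN_le X (n : nat) : Prop :=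
  exists C r0 : R, [/\ 0 < C, 0 < r0 & forall r, r0 <= r ->
    exists U : 'I_n.+1 -> set (set X),
      [/\ forall x, exists i, exists2 A, U i A & A x,
          forall i A, U i A -> diam_le A (C * r) &
          forall i, scale_disjoint r (U i)]].

Definition asdimAN X : option nat := least (asdimAN_le X).

(* Functions on [0, +oo[ are restrictions of functions on R. *)
Definition asymptotically_sublinear (s : R -> R) : Prop :=
  [/\ {within `[0, +oo[, continuous s},
      forall r, 0 <= r -> 0 <= s r &
      forall a, 0 < a -> exists M' : R, forall r, 0 <= r -> s r <= a * r + M'].

Definition higson_sublinear X (x0 : X) Y (f : X -> Y) : Prop :=
  continuous f /\
  forall s, asymptotically_sublinear s ->
  forall x y : nat -> X,
    mdist (x n) x0 @[n --> \oo] --> +oo ->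
    mdist (y n) x0 @[n --> \oo] --> +oo ->
    (forall n, mdist (x n) (y n) <= s (mdist (x n) x0)) ->
    mdist (f (x n)) (f (y n)) @[n --> \oo] --> (0 : R).

End MetricNotions.

Definition topological_embedding (S T : topologicalType) (j : S -> T) : Prop :=
  injective j /\ forall A : set S, open A <-> exists2 B, open B & j @^-1` B = A.

Definition compactification (S T : topologicalType) (j : S -> T) : Prop :=
  [/\ compact [set: T], hausdorff_space T,
      topological_embedding j & dense (range j)].

(* [j : X -> hX] exhibits [hX] as the compactification h_L(X), which is unique
   up to a homeomorphism fixing X.  The metric structure on R is carried by
   [R^o]. *)
Definition higson_sublinear_compactification (R : realType) (X : metricType R)
    (x0 : X) (hX : topologicalType) (j : X -> hX) : Prop :=
  compactification j /\
  forall f : X -> R^o, continuous f -> bounded_fun f ->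
    (exists2 g : hX -> R^o, continuous g & forall x, g (j x) = f x)
    <-> higson_sublinear x0 f.

(* As a [set_type], it carries the topology induced from [hX]. *)
Definition corona (S T : topologicalType) (j : S -> T) : topologicalType :=
  set_type (~` range j).

Definition covdim_le (T : topologicalType) (n : nat) : Prop :=
  forall U : set (set T),
    finite_set U -> (forall A, U A -> open A) -> \bigcup_(A in U) A = setT ->
  exists V : set (set T),
    [/\ finite_set V, forall B, V B -> open B, \bigcup_(B in V) B = setT,
        forall B, V B -> exists2 A, U A & B `<=` A &
        forall x, [set B | V B /\ B x] #<= `I_n.+1].

(* As for [asdimAN], the least n >= 0: the empty space has dimension 0. *)
Definition covdim (T : topologicalType) : option nat := least (@covdim_le T).

(* Main.v *)
From HB Require Import structures.
Require Import Defs.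
From mathcomp Require Import all_boot all_order all_algebra.
From mathcomp Require Import all_classical all_reals all_analysis.
From mathcomp Require Import lra ring.

(** Why the theorem is true.

A continuous function extends over the compactification exactly when it is
Higson sublinear, and far from the base point this is uniform continuity for
the distance-ratio metric D(x, y) = ln (1 + d(x, y) / min (h x, h y)) with
h x = 1 + |x| (slow_of_higson_sublinear and higson_sublinear_lipschitz).  So
the corona only knows (X, D) near infinity.  The notion that links the two
dimensions is [controlled n]: for every ep > 0 there are de > 0 and a coloring
of the far part of X in n + 1 colors such that the points of each color split
into pieces of diameter at most ep at mutual distance at least de.  For D, being controlled is
implied by a bound on asdim_AN and implies one on the covering dimension of
the corona; both implications can be reversed once X has some finite
asymptotic dimension m.

- asdim_AN X <= n gives a coloring of each dyadic annulus 2^p <= h < 2^(p+1),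
  at the scale of 2^p.  Annuli of the same parity are far apart, and the union
  of two controlled families is controlled (controlled_of_asdimAN_le).

- A coloring yields an open cover of the corona of multiplicity n + 1.  Given
  an open cover of the corona, merge the small pieces of one color that lie in
  the same member; the tents over the merged sets are D-Lipschitz, hence
  extend, and distinct tents of the same color have disjoint supports
  (covdim_le_of_controlled).

- Conversely let X be controlled in dimension m and dim of the corona be at
  most n.  The m + 1 color classes define an open cover of the corona; refine
  it with multiplicity n + 1 and extend a subordinate family of functions to
  X.  Near infinity at most n + 1 of them are noticeably positive, so
  their values at x miss one of n + 1 fixed intervals.  Which interval is
  missed is the color of x; the set of functions above it is locally constant
  within a color and points to one of the m + 1 classes, whose small pieces cut
  it into pieces of small diameter (empty_gap and controlled_of_covdim_le).

- Being controlled says that balls of radius t around points at distance about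
  t from the base point have colorings with constants relative to t.  By
  cocompactness all balls of radius t do.  A decomposition of X by asdim_AN <= m
  at scale t has m + 1 classes made of pieces of size comparable to t; these are
  controlled for d / t, and so is their union X (asdimAN_le_of_controlled). *)

Set Implicit Arguments.
Unset Strict Implicit.
Unset Printing Implicit Defensive.

Import Order.TTheory GRing.Theory Num.Theory.
Import numFieldNormedType.Exports.
Local Open Scope classical_set_scope.
Local Open Scope ring_scope.
Local Open Scope card_scope.

(** * Colorings of pseudometric spaces *)

Section Colorings.
Context {R : realType}.
Implicit Types T : Type.

Definition pseudometric_fun T (D : T -> T -> R) : Prop :=
  [/\ forall x, D x x = 0, forall x y, D x y = D y x &
      forall x y z, D x z <= D x y + D y z].

(** The label names the member of the cover that contains the point: points
with the same color and the same label form one member of the family of that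
color, with [de] a lower bound for the gaps and [ep] an upper bound for the
diameters.  Working with functions avoids families of families of sets. *)
Definition colored n T (Y : set T) (D : T -> T -> R) (de ep : R) : Prop :=
  exists (c : T -> 'I_n.+1) (l : T -> set T),
    (forall x y, Y x -> Y y -> c x = c y -> D x y < de -> l x = l y) /\
    (forall x y, Y x -> Y y -> c x = c y -> l x = l y -> D x y <= ep).

(** Labels of any type can be replaced by the class that they define. *)
Lemma colored_of_labels n T (Y : set T) (D : T -> T -> R) de ep (L : Type)
    (c : T -> 'I_n.+1) (l : T -> L) :
  (forall x y, Y x -> Y y -> c x = c y -> D x y < de -> l x = l y) ->
  (forall x y, Y x -> Y y -> c x = c y -> l x = l y -> D x y <= ep) ->
  colored n Y D de ep.
Proof.
move=> near_eq eq_small; exists c, (fun x => [set y | c y = c x /\ l y = l x]).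
split=> x y Yx Yy cxy.
  move=> Dxy; have lxy := near_eq _ _ Yx Yy cxy Dxy.
  by apply/seteqP; split=> z /=; rewrite cxy lxy.
move=> sxy; apply: eq_small => //.
by have : [set z | c z = c x /\ l z = l x] x by []; rewrite sxy => -[].
Qed.

Lemma colored_pullback n T T' (f : T' -> T) (Y : set T) (Y' : set T')
    (D : T -> T -> R) (D' : T' -> T' -> R) de ep de' ep' :
  colored n Y D de ep -> (forall x, Y' x -> Y (f x)) ->
  (forall x y, Y' x -> Y' y -> D' x y < de' -> D (f x) (f y) < de) ->
  (forall x y, Y' x -> Y' y -> D (f x) (f y) <= ep -> D' x y <= ep') ->
  colored n Y' D' de' ep'.
Proof.
move=> [c [l [near_eq eq_small]]] fY fde fep.
apply: (@colored_of_labels n _ _ _ _ _ _ (c \o f) (l \o f)) => x y Yx Yy /=.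
  by move=> cxy /(fde _ _ Yx Yy); apply: near_eq => //; apply: fY.
by move=> cxy lxy; apply: fep => //; apply: eq_small => //; apply: fY.
Qed.

Lemma coloredW n T (Y Y' : set T) (D : T -> T -> R) de ep de' ep' :
  Y' `<=` Y -> de' <= de -> ep <= ep' ->
  colored n Y D de ep -> colored n Y' D de' ep'.
Proof.
move=> YY dele epe /(@colored_pullback n T T id); apply=> //.
  by move=> x y _ _ /lt_le_trans; apply.
by move=> x y _ _ /le_trans; apply.
Qed.

(** Colorings of pieces at mutual distance at least [de] fit together, since
the piece itself can be made part of the label. *)
Lemma colored_glue n T (I : Type) (pi : T -> I) (Y : set T)
    (D : T -> T -> R) de ep :
  (forall x y, Y x -> Y y -> D x y < de -> pi x = pi y) ->
  (forall x, Y x -> colored n [set y | Y y /\ pi y = pi x] D de ep) ->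
  colored n Y D de ep.
Proof.
move=> sep col.
have /choice[F FP] : forall i : I, exists F : (T -> 'I_n.+1) * (T -> set T),
  let Z := [set y | Y y /\ pi y = i] in
  (forall x y, Z x -> Z y -> F.1 x = F.1 y -> D x y < de -> F.2 x = F.2 y) /\
  (forall x y, Z x -> Z y -> F.1 x = F.1 y -> F.2 x = F.2 y -> D x y <= ep).
  move=> i; have [[x [Yx <-]]|nYi] := pselect (exists x, Y x /\ pi x = i).
    by have [c [l cl]] := col x Yx; exists (c, l).
  by exists (fun=> ord0, fun=> set0); split=> x y [Yx pix]; case: nYi; exists x.
apply: (@colored_of_labels n _ _ _ _ _ _ (fun x => (F (pi x)).1 x)
  (fun x => (pi x, (F (pi x)).2 x))) => x y Yx Yy cxy.
  move=> Dxy; have pxy := sep _ _ Yx Yy Dxy; congr pair => //.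
  rewrite pxy in cxy *; have [H _] := FP (pi y); exact: H.
move=> [pxy]; rewrite pxy in cxy * => lxy.
by have [_ H] := FP (pi y); exact: H.
Qed.

(** The coarse coloring of [Y2] absorbs the nearby members of the fine coloring
of [Y1].  As the members of [Y1] are small compared with the gaps [d2], each of
them is absorbed by at most one member of [Y2] of its color, so the gaps
survive at the level [de]. *)
Lemma colored_union n T (D : T -> T -> R) (Y1 Y2 : set T) d1 e1 d2 e2 de :
  pseudometric_fun D -> 0 <= e1 -> 0 <= e2 -> 0 <= de ->
  de <= d1 -> 2 * de + e1 < d2 ->
  colored n Y1 D d1 e1 -> colored n Y2 D d2 e2 ->
  colored n (Y1 `|` Y2) D de (e2 + 2 * (e1 + de)).
Proof.
move=> [Dxx Dsym Dtri] e10 e20 de0 de1 de2 [c1 [l1 [ne1 es1]]] [c2 [l2 [ne2 es2]]].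
(* near1 i L y: the member (i, L) of the first coloring comes close to y. *)
pose near1 (i : 'I_n.+1) (L : set T) (y : T) := exists x,
  [/\ Y1 x, c1 x = i, l1 x = L & [/\ Y2 y, c2 y = i & D x y < de]].
pose lab1 i L : set T + set T := match pselect (exists y, near1 i L y) with
  | left ex => inr (l2 (projT1 (cid ex))) | right _ => inl L end.
have lab1r i L K : lab1 i L = inr K -> exists2 y, near1 i L y & l2 y = K.
  rewrite /lab1; case: pselect => // ex [<-].
  by case: (cid ex) => y ny; exists y.
have lab1l i L K : lab1 i L = inl K -> L = K /\ ~ exists y, near1 i L y.
  by rewrite /lab1; case: pselect => // nex [].
pose c x := if pselect (Y2 x) then c2 x else c1 x.
pose l x := if pselect (Y2 x) then inr (l2 x) else lab1 (c1 x) (l1 x).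
have spread x i K : Y1 x -> c1 x = i -> lab1 i (l1 x) = inr K ->
    exists y, [/\ Y2 y, c2 y = i, l2 y = K & D x y <= e1 + de].
  move=> Y1x c1x /lab1r[y [z [Y1z c1z l1z [Y2y c2y Dzy]]] l2y].
  exists y; split=> //; apply: (le_trans (Dtri x z y)); apply: lerD (ltW Dzy).
  by apply: es1; rewrite // c1z.
have mixed x y : Y1 x -> Y2 y -> c1 x = c2 y -> D x y < de ->
    lab1 (c1 x) (l1 x) = inr (l2 y).
  move=> Y1x Y2y cxy Dxy.
  case E: (lab1 (c1 x) (l1 x)) => [K|K].
    by have [_ []] := lab1l _ _ _ E; exists y, x; split.
  have [y' [Y2y' c2y' <- Dxy']] := spread _ _ _ Y1x erefl E; congr inr.
  apply: ne2; rewrite // ?c2y' //.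
  have := Dtri y' x y; rewrite (Dsym y' x); lra.
have Dmix x y : Y1 x -> Y2 y -> c1 x = c2 y ->
    lab1 (c1 x) (l1 x) = inr (l2 y) -> D x y <= e2 + 2 * (e1 + de).
  move=> Y1x Y2y cxy /(spread _ _ _ Y1x erefl)[y' [Y2y' c2y' l2y' Dxy']].
  have := Dtri x y' y; have : D y' y <= e2 by apply: es2; rewrite ?c2y'.
  lra.
apply: (@colored_of_labels n _ _ _ _ _ _ c l) => x y Yx Yy; rewrite /c /l;
  case: pselect => Y2x; case: pselect => Y2y /= cxy.
- by move=> Dxy; congr inr; apply: ne2 => //; lra.
- by case: Yy => // Y1y; rewrite Dsym => Dyx; rewrite (mixed y x).
- by case: Yx => // Y1x Dxy; rewrite (mixed x y).
- case: Yx Yy => // Y1x [] // Y1y Dxy; rewrite cxy; congr lab1.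
  by apply: ne1 => //; lra.
- by case=> lxy; have := es2 _ _ Y2x Y2y cxy lxy; lra.
- by case: Yy => // Y1y /esym lxy; rewrite Dsym; apply: Dmix.
- by case: Yx => // Y1x lxy; apply: Dmix.
- case: Yx Yy => // Y1x [] // Y1y lxy.
  case E: (lab1 (c1 y) (l1 y)) lxy => [K|K] Ex.
    have [ly _] := lab1l _ _ _ E; have [lx _] := lab1l _ _ _ Ex.
    have : D x y <= e1 by apply: es1; rewrite // lx ly.
    lra.
  have [y' [Y2y' c2y' l2y' Dyy']] := spread _ _ _ Y1y erefl E.
  have [x' [Y2x' c2x' l2x' Dxx']] := spread _ _ _ Y1x erefl Ex.
  have : D x' y' <= e2 by apply: es2; rewrite // ?c2x' ?c2y' ?l2x' ?l2y'.
  have := Dtri x x' y; have := Dtri x' y' y; rewrite (Dsym y' y); lra.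
Qed.

(** The parameter serves two purposes: in one use [Y t] recedes to infinity and
[D] is fixed, in the other [D t] is the metric rescaled by t.  It is essential
that [de] be chosen before t. *)
Definition controlled n T (Y : R -> set T) (D : R -> T -> T -> R) : Prop :=
  forall ep, 0 < ep -> exists2 de, 0 < de &
    exists t0, forall t, t0 <= t -> colored n (Y t) (D t) de ep.

(** The gap obtained for [Y2] dictates the size of the members used for [Y1];
this is where a coloring at every scale [ep] is needed. *)
Lemma controlled_union n T (D : R -> T -> T -> R) (Y1 Y2 : R -> set T) t1 :
  (forall t, t1 <= t -> pseudometric_fun (D t)) ->
  controlled n Y1 D -> controlled n Y2 D ->
  controlled n (fun t => Y1 t `|` Y2 t) D.
Proof.
move=> Dpm con1 con2 ep ep0.
have [|d2 d20 [s2 con2']] := con2 (ep / 2); first lra.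
pose m := Num.min d2 ep; have m0 : 0 < m by rewrite lt_min d20.
have [md2 mep] : m <= d2 /\ m <= ep by rewrite /m !ge_min !lexx orbT.
have [|d1 d10 [s1 con1']] := con1 (m / 8); first lra.
exists (Num.min d1 (m / 8)); first by rewrite lt_min d10 /=; lra.
set de := Num.min _ _.
have [ded1 dem] : de <= d1 /\ de <= m / 8 by rewrite /de !ge_min !lexx orbT.
have de0 : 0 < de by rewrite /de lt_min d10 /=; lra.
exists (Num.max t1 (Num.max s1 s2)) => t; rewrite !ge_max => /and3P[tt1 ts1 ts2].
have : colored n (Y1 t `|` Y2 t) (D t) de (ep / 2 + 2 * (m / 8 + de)).
  apply: (colored_union (Dpm t tt1) _ _ _ ded1 _ (con1' t ts1) (con2' t ts2));
  lra.
by apply: coloredW => //; lra.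
Qed.

Lemma controlled_bigunion n T (D : R -> T -> T -> R) N
    (Y : 'I_N -> R -> set T) t1 :
  (forall t, t1 <= t -> pseudometric_fun (D t)) ->
  (forall i, controlled n (Y i) D) ->
  controlled n (fun t => \bigcup_i Y i t) D.
Proof.
move=> Dpm; elim: N => [|N IHN] in Y *; move=> con.
  move=> ep ep0; exists 1 => //; exists 0 => t _.
  by exists (fun=> ord0), (fun=> set0); split=> x y [[]].
have := controlled_union Dpm (con ord0)
  (IHN (fun i => Y (lift ord0 i)) (fun i => con (lift ord0 i))).
move=> H ep /H[de de0 [t0 col]]; exists de => //; exists t0 => t /col.
apply: coloredW => // x [i _]; case: (unliftP ord0 i) => [k|] -> Yx; last by left.
by right; exists k.
Qed.

End Colorings.

(** * The distance-ratio metric and the dimension of the ends *)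

Section RatioMetric.
Context {R : realType} {X : metricType R} (x0 : X).

Definition height (x : X) : R := 1 + mdist x x0.

(** The distance-ratio metric: at height h it looks like d / h, so that moving
by a small D-distance is moving by a small fraction of the height.  The
logarithm makes it satisfy the triangle inequality. *)
Definition ratio_dist (x y : X) : R :=
  ln (1 + mdist x y / Num.min (height x) (height y)).

Definition far (t : R) : set X := [set x | t <= height x].

Lemma height_ge1 x : 1 <= height x.
Proof. by rewrite /height lerDl mdist_ge0. Qed.

Lemma height_gt0 x : 0 < height x.
Proof. by rewrite (lt_le_trans _ (height_ge1 x)). Qed.

Lemma height_lip x y : height x <= height y + mdist x y.
Proof.
rewrite /height; have := metric_triangle x y x0; lra.
Qed.

Let minh_gt0 x y : 0 < Num.min (height x) (height y).
Proof. by rewrite lt_min !height_gt0. Qed.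

Lemma ratio_lt x y q : 0 <= q ->
  (ratio_dist x y < ln (1 + q)) = (mdist x y < q * Num.min (height x) (height y)).
Proof.
move=> q0; have d0 := mdist_ge0 x y.
rewrite ltr_ln ?posrE ?ltrD2l ?ltr_pdivrMr //; last lra.
by rewrite (lt_le_trans ltr01) // lerDl divr_ge0 // ltW.
Qed.

Lemma ratio_le x y q : 0 <= q ->
  (ratio_dist x y <= ln (1 + q)) = (mdist x y <= q * Num.min (height x) (height y)).
Proof.
move=> q0; have d0 := mdist_ge0 x y.
rewrite ler_ln ?posrE ?lerD2l ?ler_pdivrMr //; last lra.
by rewrite (lt_le_trans ltr01) // lerDl divr_ge0 // ltW.
Qed.

Lemma ratio_ge0 x y : 0 <= ratio_dist x y.
Proof. by rewrite ln_ge0 // lerDl divr_ge0 ?mdist_ge0 // ltW. Qed.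

Lemma ratio_le_div x y :
  ratio_dist x y <= mdist x y / Num.min (height x) (height y).
Proof.
apply: le_ln1Dx; rewrite (lt_le_trans (ltrN10 _)) // divr_ge0 ?mdist_ge0 //.
exact: ltW.
Qed.

Lemma ratio_le_mdist x y : ratio_dist x y <= mdist x y.
Proof.
apply: (le_trans (ratio_le_div x y)); rewrite ler_pdivrMr // ler_peMr ?mdist_ge0 //.
by rewrite le_min !height_ge1.
Qed.

Lemma exists_ln1D (e : R) : 0 < e -> exists2 q, 0 < q & ln (1 + q) = e.
Proof.
move=> e0; exists (expR e - 1); first by rewrite subr_gt0 expR_gt1.
by rewrite addrC subrK expRK.
Qed.

(** It suffices to treat [height x <= height z], where the claim multiplied out
follows from [height y <= height x + mdist x y]. *)
Lemma ratio_pseudometric : pseudometric_fun ratio_dist.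
Proof.
have Dsym x y : ratio_dist x y = ratio_dist y x.
  by rewrite /ratio_dist metric_sym minC.
split=> // [x|]; first by rewrite /ratio_dist mdistxx mul0r addr0 ln1.
have tri x y z : height x <= height z ->
    ratio_dist x z <= ratio_dist x y + ratio_dist y z.
  move=> hxz; have xy0 := mdist_ge0 x y; have yz0 := mdist_ge0 y z.
  rewrite /ratio_dist -lnM ?posrE; last 2 first.
  - by rewrite ltr_wpDr // divr_ge0 // ltW.
  - by rewrite ltr_wpDr // divr_ge0 // ltW.
  rewrite ler_ln ?posrE; last 2 first.
  - by rewrite ltr_wpDr // divr_ge0 ?mdist_ge0 // ltW.
  - by rewrite mulr_gt0 // ltr_wpDr // divr_ge0 // ltW.
  rewrite (min_idPl hxz); have hx := height_gt0 x; have hy := height_gt0 y.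
  have step1 : 1 + mdist x y / height x <= 1 + mdist x y / Num.min (height x) (height y).
    by rewrite lerD2l ler_wpM2l // lef_pV2 ?posrE // ge_min lexx.
  have step2 : 1 + mdist y z / height y <= 1 + mdist y z / Num.min (height y) (height z).
    by rewrite lerD2l ler_wpM2l // lef_pV2 ?posrE // ge_min lexx.
  apply: (@le_trans _ _ ((1 + mdist x y / height x) * (1 + mdist y z / height y))).
    2: by apply: ler_pM => //; rewrite addr_ge0 // divr_ge0 // ltW.
  have lip : height y / height x <= 1 + mdist x y / height x.
    rewrite ler_pdivrMr // mulrDl mul1r divfK ?gt_eqF //.
    by have := height_lip y x; rewrite (metric_sym y x).
  rewrite mulrDr mulr1 -addrA lerD2l.
  apply: (@le_trans _ _ (mdist x y / height x + mdist y z / height x)).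
    rewrite -mulrDl ler_wpM2r // ?invr_ge0 ?(ltW hx) //; exact: metric_triangle.
  rewrite lerD2l.
  have -> : mdist y z / height x = (height y / height x) * (mdist y z / height y).
    by field; rewrite !gt_eqF.
  by apply: ler_wpM2r => //; rewrite divr_ge0 // ltW.
move=> x y z; have [/tri//|/ltW/(tri z y x)] := leP (height x) (height z).
by rewrite addrC Dsym (Dsym y x) (Dsym z y).
Qed.

End RatioMetric.
Arguments ratio_dist {R X} x0 x y.

Section AsdimColored.
Context {R : realType} {X : metricType R}.

(** One coloring with gaps r and diameters C r packs the n + 1 families. *)
Lemma asdimAN_leP n : asdimAN_le X n <-> exists C r0 : R, [/\ 0 < C, 0 < r0 &
  forall r, r0 <= r -> colored n [set: X] (@mdist R X) r (C * r)].
Proof.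
split=> -[C [r0 [C0 r00 H]]]; exists C, r0; split=> // r /H {H}.
  move=> [U [cov diam disj]].
  have /choice[F FP] : forall x, exists F : 'I_n.+1 * set X,
      U F.1 F.2 /\ F.2 x.
    by move=> x; have [i [A UA Ax]] := cov x; exists (i, A).
  apply: (@colored_of_labels _ n _ _ _ _ _ _ (fun x => (F x).1) (fun x => (F x).2)).
    move=> x y _ _ cxy; have [Ux xx] := FP x; have [Uy yy] := FP y.
    rewrite cxy in Ux; apply: contraPP => lxy; rewrite ltNge; apply/negP/negPn.
    exact: (disj _ _ _ Ux Uy lxy).
  move=> x y _ _ _ lxy; have [Ux xx] := FP x; have [Uy yy] := FP y.
  by apply: (diam _ _ Ux) => //; rewrite lxy.
move=> [c [l [ne es]]].
pose cls i y := [set x | c x = i /\ l x = l y].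
exists (fun i => [set cls i y | y in c @^-1` [set i]]); split.
- by move=> x; exists (c x); exists (cls (c x) x) => //; exists x.
- by move=> i _ [z _ <-] x y [cx lx] [cy ly]; apply: es; rewrite ?cx ?lx.
- move=> i _ _ [a /= ca <-] [b /= cb <-] nab x y [cx lx] [cy ly].
  rewrite leNgt; apply/negP => dxy; apply: nab.
  have lxy := ne x y I I (etrans cx (esym cy)) dxy.
  by apply/seteqP; split=> z [cz lz]; split=> //; rewrite lz -?lx -?ly ?lxy.
Qed.

Lemma dyadic_level (r : R) : 1 <= r ->
  exists p : nat, 2 ^+ p <= r < 2 ^+ p.+1.
Proof.
move=> r1; have exP : exists p : nat, r < 2 ^+ p.
  exists (Num.truncn r).+1; apply: lt_trans (_ : (Num.truncn r).+1%:R < _).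
    exact: truncnS_gt.
  by rewrite -natrX ltr_nat ltn_expl.
case: (ex_minnP exP) => -[|p] rp minp; first by move: rp; rewrite expr0 ltNge r1.
by exists p; rewrite rp andbT leNgt; apply/negP => /minp; rewrite ltnn.
Qed.

(** On the annulus of level p small D-distances are d / 2^p up to a factor, so a
coloring for d at the scale 2^p is one for D with constants that do not depend
on p.  Consecutive annuli touch, but annuli of the same parity are at D-distance
at least ln 2; hence the even and the odd annuli are treated separately. *)
Lemma controlled_of_asdimAN_le (x0 : X) n : asdimAN_le X n ->
  controlled n (far x0) (fun=> ratio_dist x0).
Proof.
move=> /asdimAN_leP[C [r0 [C0 r00 col]]].
have /choice[p pP] : forall x, exists p : nat, 2 ^+ p <= height x0 x < 2 ^+ p.+1.
  by move=> x; apply: dyadic_level; apply: height_ge1.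
pose parity b (t : R) := far x0 t `&` [set x | odd (p x) = b].
(* The two parity classes are glued by the union theorem. *)
suff con b : controlled n (parity b) (fun=> ratio_dist x0).
  have := controlled_union (t1 := 0) (fun _ _ => ratio_pseudometric x0)
    (con true) (con false).
  move=> H ep /H[de de0 [t0 H']]; exists de => //; exists t0 => t /H'.
  by apply: coloredW => // x fx; case E: (odd (p x)); [left|right].
move=> ep /exists_ln1D[q q0 <-].
pose q' := Num.min 1 (q / (2 * C)).
have qC0 : 0 < q / (2 * C) by rewrite divr_gt0 // mulr_gt0.
have q'0 : 0 < q' by rewrite /q' lt_min ltr01.
have [q'1 q'C] : q' <= 1 /\ q' <= q / (2 * C) by rewrite !ge_min !lexx orbT.
exists (ln (1 + q')); first by rewrite ln_gt0 // ltrDl.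
exists (2 * (r0 * C / q)) => t tt0.
apply: (@colored_glue _ n _ nat p) => [x y [fx px] [fy py]|x [fx px]].
  rewrite ratio_lt ?(ltW q'0) // => dxy.
  (* Between two levels of the same parity lies a whole annulus, whose width is
     at least the height of the lower point. *)
  have sep a b' : odd (p a) = b -> odd (p b') = b -> (p a < p b')%N ->
      mdist a b' < q' * Num.min (height x0 a) (height x0 b') -> False.
    move=> oa ob ltp dab.
    have {}ltp : ((p a).+2 <= p b')%N.
      rewrite ltn_neqAle ltp andbT; apply/eqP => E.
      by move: ob; rewrite -E /= oa; case: (b).
    have /andP[_ ha] := pP a; have /andP[hb _] := pP b'.
    have h2 : (2 : R) ^+ (p a).+2 <= 2 ^+ p b' by rewrite ler_weXn2l //; lra.
    have := height_lip x0 b' a; rewrite metric_sym => hlip.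
    have : q' * Num.min (height x0 a) (height x0 b') <= height x0 a.
      rewrite -[leRHS]mul1r ler_pM // ?(ltW q'0) ?ge_min ?lexx //.
      by rewrite le_min !ltW // height_gt0.
    rewrite exprS in h2; lra.
  case: (ltngtP (p x) (p y)) => // pxy; first by case: (sep x y).
  by case: (sep y x); rewrite // metric_sym minC.
have /andP[lx ux] := pP x; pose s : R := 2 ^+ p x; rewrite exprS -/s in lx ux.
have s0 : 0 < s by rewrite exprn_gt0.
have rge : r0 <= q * s / C.
  have : 2 * (r0 * C / q) <= 2 * s by rewrite (le_trans tt0) // (le_trans fx) // ltW.
  by rewrite ler_pM2l // ler_pdivrMr // ler_pdivlMr // (mulrC q).
have /(@colored_pullback _ n _ _ id) := col _ rge; apply=> //.
  move=> y z [[_ _] py] [[_ _] pz]; rewrite ratio_lt ?(ltW q'0) //.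
  move=> /lt_le_trans; apply; have /andP[_ hy] := pP y; rewrite py exprS -/s in hy.
  apply: (@le_trans _ _ (q / (2 * C) * (2 * s))).
    apply: ler_pM; rewrite ?(ltW q'0) // ?le_min ?(ltW (height_gt0 _ _)) //.
    by rewrite ge_min (ltW hy).
  by rewrite le_eqVlt; apply/orP; left; apply/eqP; field; rewrite gt_eqF.
move=> y z [[_ _] py] [[_ _] pz]; rewrite ratio_le ?(ltW q0) //.
have -> : C * (q * s / C) = q * s by field; rewrite gt_eqF.
move=> /le_trans; apply; rewrite ler_pM2l // le_min.
by have /andP[+ _] := pP y; have /andP[+ _] := pP z; rewrite py pz => -> ->.
Qed.

End AsdimColored.

(** * From large scales to all scales in a homogeneous space *)

Section Homogeneous.
Context {R : realType} {X : metricType R} (x0 : X).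

Lemma lipschitz_continuous (L : R) (f : X -> R^o) :
  (forall x y, `|f x - f y| <= L * mdist x y) -> continuous f.
Proof.
move=> fL x; have L1 : 0 < Num.max L 1 by rewrite lt_max ltr01 orbT.
apply/cvgrPdist_lt => e e0.
apply/(@metricType_numDomainType.nbhs_mdistP R X); exists (e / Num.max L 1).
  by rewrite /= divr_gt0.
move=> y /=; rewrite ltr_pdivlMr // mulrC; apply: le_lt_trans.
apply: (le_trans (fL x y)); apply: ler_wpM2r; first exact: mdist_ge0.
by rewrite le_max lexx.
Qed.

Lemma mdist_continuous (a : X) : continuous ((fun x => mdist x a) : X -> R^o).
Proof.
apply: (@lipschitz_continuous 1) => x y; rewrite mul1r ler_norml.
have := metric_triangle x y a; have := metric_triangle y x a.
rewrite (metric_sym y x); lra.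
Qed.

Lemma compact_diam_le (C : set X) : compact C -> exists Q, diam_le C Q.
Proof.
move=> Cco; have cont := @mdist_continuous x0.
have /compact_bounded[B [_ HB]] : compact ((fun x => mdist x x0 : R^o) @` C).
  by apply: continuous_compact => //; apply: continuous_subspaceT.
have {}HB x : C x -> mdist x x0 <= B + 1.
  move=> Cx; apply: le_trans (ler_norm _) _.
  by apply: (HB (B + 1)); [rewrite ltrDl | exists x].
exists (2 * (B + 1)) => x y Cx Cy.
have := metric_triangle x x0 y; rewrite (metric_sym x0 y).
have := HB _ Cx; have := HB _ Cy; lra.
Qed.

(** Along a chain with steps at most M the height changes by at most M. *)
Lemma height_attained (M t : R) : scale_connected X M ->
  (exists y, t <= height x0 y) -> 1 < t ->
  exists w, t <= height x0 w <= t + M.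
Proof.
move=> conn [y ty] t1; have [p] := conn x0 y.
have base : height x0 x0 < t by rewrite /height mdistxx addr0.
suff walk x : height x0 x < t -> path (fun u v => mdist u v <= M) x p ->
  last x p = y -> exists w, t <= height x0 w <= t + M by apply: walk.
elim: p x => [|a p IHp] x /= xt.
  by move=> _ E; move: ty; rewrite -E leNgt xt.
move=> /andP[xa ap] lasty; have [at_|ta] := ltP (height x0 a) t.
  exact: IHp ap lasty.
exists a; rewrite ta /=; have := height_lip x0 a x; rewrite metric_sym; lra.
Qed.

(** A point w of height about t has a coloring of its ball of radius t / 2 at
the scale t.  An isometry carries w to within Q of a given point z, where Q
bounds the diameter of the fundamental domain, so for large t the ball of
radius t / 4 around z is covered by the image of the ball around w. *)
Lemma controlled_balls (M : R) n : cocompact X -> 0 < M -> scale_connected X M ->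
  (forall t, exists y, t <= height x0 y) ->
  controlled n (far x0) (fun=> ratio_dist x0) ->
  forall ep, 0 < ep -> exists2 de, 0 < de & exists t0, forall t, t0 <= t ->
    forall z, colored n [set x | mdist x z <= t / 4]
      (fun x y : X => mdist x y / t) de ep.
Proof.
move=> [C Cco Ccov] M0 conn unb con ep ep0; have [Q CQ] := compact_diam_le Cco.
have [|de de0 [t1 col]] := con (ln (1 + ep / 2)).
  by rewrite ln_gt0 // ltrDl divr_gt0.
have [q q0 qde] := exists_ln1D de0.
exists (q / 2); first by rewrite divr_gt0.
pose t0 := Num.max 2 (Num.max (2 * t1) (Num.max (2 * M) (4 * Q))).
exists t0 => t; rewrite !ge_max => /and4P[t2 tt1 tM tQ] z.
have t_gt0 : 0 < t by lra.
have [g [[g' gK g'K] giso] [c Cc gc]] := Ccov z.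
have [w /andP[tw wt]] : exists w, t <= height x0 w <= t + M.
  by apply: height_attained => //; lra.
have [h [hbij hiso] [c' Cc' hc']] := Ccov w.
(* The isometry h \o g' moves the ball around z into the ball around w. *)
have near_w x : mdist x z <= t / 4 -> mdist (h (g' x)) w <= t / 2.
  move=> xz; rewrite -hc' hiso; have := metric_triangle (g' x) c c'.
  have := CQ _ _ Cc Cc'; have := giso (g' x) c; rewrite g'K gc; lra.
have heights x : mdist x z <= t / 4 ->
    t / 2 <= height x0 (h (g' x)) <= 2 * t.
  move=> /near_w dw; have := height_lip x0 (h (g' x)) w.
  have := height_lip x0 w (h (g' x)); rewrite (metric_sym w); lra.
have giso' x y : mdist (h (g' x)) (h (g' y)) = mdist x y.
  by rewrite hiso -giso !g'K.
have := col (t / 2) _; move=> /(_ ltac:(lra)).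
move=> /(@colored_pullback _ n _ _ (h \o g')); apply => /=.
- by move=> x /heights /andP[].
- move=> x y /heights /andP[hx _] /heights /andP[hy _] dxy.
  rewrite -qde ratio_lt ?(ltW q0) // giso'.
  rewrite ltr_pdivrMr // in dxy; apply: (lt_le_trans dxy).
  by rewrite -mulrA ler_pM2l // mulrC le_min hx hy.
- move=> x y /heights /andP[_ hx] /heights /andP[_ hy].
  rewrite ratio_le ?giso'; last by rewrite divr_ge0 // ltW.
  move=> dxy; rewrite ler_pdivrMr //; apply: (le_trans dxy).
  rewrite -mulrA ler_pM2l // mulrC ler_pdivrMr // mulrC.
  by rewrite ge_min hx.
Qed.

Lemma mdist_pseudometric (t : R) : 0 < t ->
  pseudometric_fun (fun x y : X => mdist x y / t).
Proof.
move=> t0; split=> [x|x y|x y z]; rewrite ?mdistxx ?mul0r //.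
  by rewrite metric_sym.
by rewrite -mulrDl ler_pM2r ?invr_gt0 //; exact: metric_triangle.
Qed.

Lemma asdimAN_le_bounded n (D : R) : (forall x, height x0 x <= D) ->
  asdimAN_le X n.
Proof.
move=> hD; apply/asdimAN_leP; exists 1, (2 * D).
have D0 : 0 < D by rewrite (lt_le_trans (height_gt0 x0 x0)).
split=> [//||r rD]; first by rewrite mulr_gt0.
apply: (@colored_of_labels _ n _ _ _ _ _ unit (fun=> ord0) (fun=> tt)) => //.
move=> x y _ _ _ _; have := metric_triangle x x0 y; rewrite (metric_sym x0 y).
have := hD x; have := hD y; rewrite /height; lra.
Qed.

(** The color classes of an m-dimensional coloring at scale t split into pieces
of diameter at most C t with gaps t.  Each piece lies in a ball of radius C t,
so it has an n-dimensional coloring at every scale that is a small multiple of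
t; as the constants are uniform, each class is controlled for d / t, and X is a
union of m + 1 classes. *)
Lemma asdimAN_le_of_controlled (M : R) n m :
  cocompact X -> 0 < M -> scale_connected X M -> asdimAN_le X m ->
  controlled n (far x0) (fun=> ratio_dist x0) -> asdimAN_le X n.
Proof.
move=> cocoX M0 conn /asdimAN_leP[C [r0 [C0 r00 colm]]] con.
have [[D hD]|unb] := pselect (exists D, forall x, height x0 x <= D).
  exact: asdimAN_le_bounded hD.
have {}unb t : exists y, t <= height x0 y.
  apply: contra_notP unb => nt; exists t => x; rewrite leNgt; apply/negP => tx.
  by apply: nt; exists x; apply: ltW.
have balls := controlled_balls cocoX M0 conn unb con.
have /choice[F FP] : forall t : R, exists F : (X -> 'I_m.+1) * (X -> set X), r0 <= t ->
  (forall x y, [set: X] x -> [set: X] y -> F.1 x = F.1 y -> mdist x y < t -> F.2 x = F.2 y) /\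
  (forall x y, [set: X] x -> [set: X] y -> F.1 x = F.1 y -> F.2 x = F.2 y -> mdist x y <= C * t).
  move=> t; have [rt|tr] := leP r0 t; last first.
    by exists (fun=> ord0, fun=> set0).
  by have [c [l cl]] := colm t rt; exists (c, l).
pose Y (i : 'I_m.+1) (t : R) := [set x | (F t).1 x = i].
(* A ball of radius C * t is a quarter-ball for the scale 4 * C * t. *)
have conY i : controlled n (Y i) (fun t (x y : X) => mdist x y / t).
  move=> ep ep0; have C4 : 0 < 4 * C by rewrite mulr_gt0.
  have [|de de0 [t0 ball]] := balls (ep / (4 * C)); first by rewrite divr_gt0.
  exists (Num.min 1 (4 * C * de)); first by rewrite lt_min ltr01 mulr_gt0.
  exists (Num.max r0 (t0 / (4 * C))) => t; rewrite ge_max => /andP[rt tt].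
  have t_gt0 : 0 < t by rewrite (lt_le_trans r00).
  have [ne es] := FP t rt; apply: (@colored_glue _ n _ _ (F t).2).
    move=> x y Yx Yy; rewrite lt_min => /andP[d1 _]; apply: ne => //.
      by rewrite Yx Yy.
    by rewrite ltr_pdivrMr // mul1r in d1.
  move=> x Yx; have tb : t0 <= 4 * C * t.
    by rewrite ler_pdivrMr // in tt; rewrite mulrC.
  have /(@colored_pullback _ n _ _ id) := ball _ tb x; apply=> /=.
  - move=> y [Yy ly]; have -> : 4 * C * t / 4 = C * t by field.
    by apply: es; rewrite // ?Yy ?Yx.
  - move=> y z _ _; rewrite lt_min => /andP[_].
    rewrite ltr_pdivrMr // => d1; rewrite ltr_pdivrMr ?mulr_gt0 //.
    by have -> : de * (4 * C * t) = 4 * C * de * t by ring.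
  - move=> y z _ _; rewrite ler_pdivrMr ?mulr_gt0 // ler_pdivrMr //.
    suff -> : ep / (4 * C) * (4 * C * t) = ep * t by [].
    by field; rewrite gt_eqF.
have [||de de0 [t0 col]] := controlled_bigunion (t1 := r0) _ conY (ep := 1).
- by move=> t rt; apply: mdist_pseudometric; rewrite (lt_le_trans r00).
- exact: ltr01.
(* With ep = 1 the gaps are de * t and the diameters at most t; taking
   t = r / de turns this into gaps r and diameters r / de. *)
apply/asdimAN_leP; exists de^-1, (de * Num.max r0 t0).
split; rewrite ?invr_gt0 ?mulr_gt0 // ?lt_max ?r00 // => r.
rewrite mulrC -ler_pdivlMr // ge_max => /andP[r0r t0r].
have rde : 0 < r / de by rewrite (lt_le_trans r00).
have /(@colored_pullback _ n _ _ id) := col _ t0r; apply=> /=.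
- by move=> x _; exists ((F (r / de)).1 x).
- by move=> x y _ _ dxy; rewrite ltr_pdivrMr // mulrC divfK ?gt_eqF.
- by move=> x y _ _; rewrite ler_pdivrMr // mul1r mulrC.
Qed.

End Homogeneous.

(** * Functions that extend over the compactification *)

Section Envelope.
Context {R : realType} {I T : Type}.
Variables (W : set I) (F : I -> T -> R).

(** Adding 0 to the family makes the supremum meaningful for empty [W] and the
envelope nonnegative. *)
Definition envelope (x : T) : R := sup (0 |` [set F i x | i in W]).

Hypothesis Fbnd : forall x, exists B, forall i, W i -> F i x <= B.

Let has_supF x : has_sup (0 |` [set F i x | i in W]).
Proof.
split; first by exists 0; left.
have [B HB] := Fbnd x; exists (Num.max 0 B) => _ [->|[i Wi <-]].
  by rewrite le_max lexx.
by rewrite le_max HB // orbT.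
Qed.

Lemma envelope_ge0 x : 0 <= envelope x.
Proof. by apply: ub_le_sup; [case: (has_supF x) | left]. Qed.

Lemma envelope_ge i x : W i -> F i x <= envelope x.
Proof. by move=> Wi; apply: ub_le_sup; [case: (has_supF x) | right; exists i]. Qed.

Lemma envelope_le x B : 0 <= B -> (forall i, W i -> F i x <= B) ->
  envelope x <= B.
Proof.
move=> B0 HB; apply: ge_sup; first by exists 0; left.
by move=> _ [->//|[i Wi <-]]; apply: HB.
Qed.

Lemma envelope_gt0 x : 0 < envelope x -> exists2 i, W i & 0 < F i x.
Proof.
move=> /sup_gt[]; first by exists 0; left.
by move=> _ [->|[i Wi <-]]; [rewrite ltxx | exists i].
Qed.

(** A Lipschitz bound shared by all members of a family passes to their
supremum. *)
Lemma envelope_lip (E : T -> T -> R) :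
  (forall x y, 0 <= E x y) -> (forall x y, E x y = E y x) ->
  (forall i x y, W i -> F i x <= F i y + E x y) ->
  forall x y, `|envelope x - envelope y| <= E x y.
Proof.
move=> E0 Esym FE.
have half x y : envelope x <= envelope y + E x y.
  apply: envelope_le => [|i Wi]; first by rewrite addr_ge0 // envelope_ge0.
  by rewrite (le_trans (FE i x y Wi)) // lerD2r envelope_ge.
move=> x y; rewrite ler_norml; have := half x y; have := half y x.
rewrite Esym; lra.
Qed.

End Envelope.

Section Bump.
Context {R : realType} {T : Type} (D : T -> T -> R).
Hypothesis Dpm : pseudometric_fun D.
Variables (W : set T) (eta : R).
Hypothesis eta0 : 0 < eta.

Let cone (w x : T) : R := 1 - D x w / eta.

(** This is max (0, 1 - D(x, W) / eta), with no need for the distance to [W] to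
be defined when [W] is empty. *)
Definition tent (x : T) : R := envelope W cone x.

Lemma pseudometric_ge0 x y : 0 <= D x y.
Proof.
have [Dxx Dsym Dtri] := Dpm; have := Dtri x y x; rewrite Dxx (Dsym y x); lra.
Qed.

Let bnd x : exists B, forall w, W w -> cone w x <= B.
Proof. by exists 1 => w _; rewrite /cone gerBl divr_ge0 ?pseudometric_ge0 // ltW. Qed.

Lemma tent_ge0 x : 0 <= tent x. Proof. exact: (envelope_ge0 bnd). Qed.

Lemma tent_le1 x : tent x <= 1.
Proof.
apply: envelope_le => // w _; rewrite /cone gerBl divr_ge0 ?pseudometric_ge0 //.
exact: ltW.
Qed.

Lemma tent1 x : W x -> tent x = 1.
Proof.
move=> Wx; apply/eqP; rewrite eq_le tent_le1 /=.
have := envelope_ge bnd x Wx; have [Dxx _ _] := Dpm.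
by rewrite /cone Dxx mul0r subr0.
Qed.

Lemma tent_gt0 x : 0 < tent x -> exists2 w, W w & D x w < eta.
Proof.
move=> /(@envelope_gt0 R T T W cone x)[w Ww h]; exists w => //.
by rewrite /cone subr_gt0 ltr_pdivrMr // mul1r in h.
Qed.

Lemma tent_lip x y : `|tent x - tent y| <= eta^-1 * D x y.
Proof.
have [Dxx Dsym Dtri] := Dpm.
apply: (@envelope_lip _ _ _ _ _ bnd (fun x y => eta^-1 * D x y)) => {x y}.
- by move=> x y; rewrite mulr_ge0 ?pseudometric_ge0 // invr_ge0 ltW.
- by move=> x y; rewrite Dsym.
move=> w x y _; rewrite /cone (mulrC _ (D x y)).
have : D y w / eta <= (D x y + D x w) / eta.
  by rewrite ler_pM2r ?invr_gt0 // (Dsym x y) Dtri.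
rewrite mulrDl; lra.
Qed.

End Bump.

Section Sublinear.
Context {R : realType} {X : metricType R} (x0 : X).

(** Uniform continuity at infinity with respect to the distance-ratio metric. *)
Definition slow (f : X -> R) : Prop := forall e, 0 < e ->
  exists2 de, 0 < de & exists t, forall x y, far x0 t x -> far x0 t y ->
    ratio_dist x0 x y < de -> `|f x - f y| < e.

(** The supremum of the functions r |-> d_n - |r - rho_n|, where
d_n = mdist (x n) (y n) and rho_n = |x n|, is 1-Lipschitz and takes a value at
least d_n at rho_n.  It is sublinear since the n-th function is at most
(r + 1) / (n + 1): all but finitely many lie below a given line, and each of
the others is bounded by d_n. *)
Lemma sublinear_gauge (x y : nat -> X) :
  (forall n, mdist (x n) (y n) <= n.+1%:R^-1 * (1 + mdist (x n) x0)) ->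
  exists2 s : R -> R, asymptotically_sublinear s &
    forall n, mdist (x n) (y n) <= s (mdist (x n) x0).
Proof.
move=> xy; pose d n := mdist (x n) (y n); pose rho n := mdist (x n) x0.
pose F n r := d n - `|r - rho n|.
have d0 n : 0 <= d n by apply: mdist_ge0.
have inv1 n : (n.+1%:R^-1 : R) <= 1 by rewrite invf_le1 ?ler1n ?ltr0n.
have inv0 n : 0 < (n.+1%:R^-1 : R) by rewrite invr_gt0 ltr0n.
have F_le n r : F n r <= n.+1%:R^-1 * (r + 1).
  have := xy n; have := inv1 n; have := inv0 n.
  rewrite -/(d n) -/(rho n) /F; move: (n.+1%:R^-1) => q q0 q1 dq.
  have qa : q * `|r - rho n| <= `|r - rho n| by rewrite ler_piMl.
  have : q * (rho n - r) <= q * `|r - rho n|.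
    by rewrite ler_pM2l // distrC ler_norm.
  rewrite mulrDr mulr1 in dq; rewrite mulrBr mulrDr mulr1; lra.
have Fbnd r : exists B, forall n, setT n -> F n r <= B.
  exists (`|r| + 1) => n _; apply: (le_trans (F_le n r)).
  apply: (@le_trans _ _ (n.+1%:R^-1 * (`|r| + 1))).
    by rewrite ler_pM2l // lerD2r ler_norm.
  by rewrite ler_piMl // addr_ge0.
exists (envelope setT F); last first.
  move=> n; have := @envelope_ge _ _ _ _ _ Fbnd n (rho n) I.
  by rewrite /F subrr normr0 subr0.
split=> [|r _|a a0].
- apply: continuous_subspaceT.
  apply: (@lipschitz_continuous R R^o 1) => r r'; rewrite mul1r.
  apply: (@envelope_lip _ _ _ _ _ Fbnd (fun u v : R => mdist (u : R^o) v)) => {r r'}.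
  + by move=> *; apply: mdist_ge0.
  + by move=> *; apply: metric_sym.
  move=> n r r' _; rewrite /F -[mdist _ _]/(`|r' - r|).
  have := ler_distD r r' (rho n); lra.
- exact: (envelope_ge0 Fbnd).
pose N := Num.truncn a^-1.
have Na n : (N <= n)%N -> (n.+1%:R^-1 : R) <= a.
  move=> Nn; rewrite -[leRHS]invrK lef_pV2 ?posrE ?invr_gt0 //.
  rewrite (le_trans (ltW (truncnS_gt _))) // ler_nat //.
exists (a + \sum_(n < N) d n) => r r0.
have S0 : 0 <= \sum_(n < N) d n by apply: sumr_ge0.
have ar0 : 0 <= a * r by rewrite mulr_ge0 // ltW.
apply: envelope_le => [|n _]; first by rewrite !addr_ge0 // ltW.
have [nN|/Na Nn] := ltnP n N; last first.
  apply: (le_trans (F_le n r)).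
  have : n.+1%:R^-1 * (r + 1) <= a * (r + 1) by rewrite ler_wpM2r // addr_ge0.
  by move=> /le_trans; apply; rewrite mulrDr mulr1; lra.
have : d n <= \sum_(n < N) d n.
  by rewrite (bigD1 (Ordinal nN)) //= lerDl sumr_ge0.
have : F n r <= d n by rewrite gerBl.
lra.
Qed.

(** A failure of uniform continuity at infinity produces pairs whose distance
is o(|x_n|), and some sublinear function dominates these distances. *)
Lemma slow_of_higson_sublinear (f : X -> R^o) : higson_sublinear x0 f -> slow f.
Proof.
move=> [_ Hf] e e0; apply: contrapT => nslow.
have /choice[xy xyP] : forall n : nat, exists p : X * X,
    [/\ far x0 (n%:R + 1) p.1, far x0 (n%:R + 1) p.2,
        ratio_dist x0 p.1 p.2 < ln (1 + n.+1%:R^-1) & e <= `|f p.1 - f p.2|].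
  move=> n; apply: contra_notP nslow => nxy.
  exists (ln (1 + n.+1%:R^-1)).
    by rewrite ln_gt0 // ltrDl invr_gt0 ltr0n.
  exists (n%:R + 1) => x y fx fy dxy; rewrite ltNge; apply/negP => exy.
  by apply: nxy; exists (x, y).
have [s sub sxy] : exists2 s : R -> R, asymptotically_sublinear s &
    forall n, mdist (xy n).1 (xy n).2 <= s (mdist (xy n).1 x0).
  apply: (@sublinear_gauge (fun n => (xy n).1) (fun n => (xy n).2)) => n.
  have [_ _ + _] := xyP n; rewrite ratio_lt ?invr_ge0 ?ler0n // => /ltW.
  move=> /le_trans; apply; rewrite ler_pM2l ?invr_gt0 ?ltr0n //.
  by rewrite ge_min lexx.
have infty (z : nat -> X) : (forall n, far x0 (n%:R + 1) (z n)) ->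
    mdist (z n) x0 @[n --> \oo] --> +oo.
  move=> fz; apply: (ger_cvgy (f := fun n => n%:R : R)); last exact: cvgr_idn.
  by apply: nearW => n; have := fz n; rewrite /far /= /height; lra.
have := Hf s sub _ _ (infty (fun n => (xy n).1) _) (infty (fun n => (xy n).2) _) sxy.
move=> /(_ (fun n => let: And4 a _ _ _ := xyP n in a)).
move=> /(_ (fun n => let: And4 _ a _ _ := xyP n in a)).
move=> /cvgrPdist_lt /(_ e e0) [N _ /(_ N (leqnn N))] /=.
have [_ _ _] := xyP N; rewrite /mdist /= sub0r normrN normr_id distrC.
by move=> /le_lt_trans /[apply]; rewrite ltxx.
Qed.

(** If d(x_n, y_n) <= s(|x_n|) with s sublinear then D(x_n, y_n) tends to 0. *)
Lemma higson_sublinear_lipschitz (L : R) (f : X -> R^o) :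
  (forall x y, `|f x - f y| <= L * ratio_dist x0 x y) -> higson_sublinear x0 f.
Proof.
move=> fL; pose L' := Num.max L 1.
have L'0 : 0 < L' by rewrite lt_max ltr01 orbT.
have {}fL x y : `|f x - f y| <= L' * ratio_dist x0 x y.
  apply: (le_trans (fL x y)); apply: ler_wpM2r; first exact: ratio_ge0.
  by rewrite le_max lexx.
split.
  apply: (@lipschitz_continuous _ _ L') => x y; apply: (le_trans (fL x y)).
  by rewrite ler_pM2l // ratio_le_mdist.
move=> s [_ _ ssub] x y xoo _ xys; apply/cvgrPdist_lt => e e0.
have [q q0 qe] : exists2 q, 0 < q & ln (1 + q) = e / L'.
  by apply: exists_ln1D; rewrite divr_gt0.
(* For large n the distance is below 2 a times the height of x n, so the height
   of y n is at least 1 - 2 a times that of x n; this a makes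
   2 a <= q (1 - 2 a). *)
pose a := q / (4 * (1 + q)).
have q1 : 0 < 1 + q by lra.
have aq : 4 * a * (1 + q) = q by rewrite /a; field; rewrite gt_eqF.
have a0 : 0 < a by rewrite divr_gt0 // mulr_gt0.
have [M' sM] := ssub a a0.
have /cvgryPge/(_ (M' / a)) [N _ xN] := xoo.
exists N => // n /xN /=; rewrite ler_pdivrMr // => Mx.
rewrite sub0r normrN /mdist /= normr_id distrC.
apply: (le_lt_trans (fL _ _)); rewrite mulrC -ltr_pdivlMr // -qe.
rewrite ratio_lt ?(ltW q0) //.
have dx : mdist (x n) (y n) <= 2 * a * mdist (x n) x0.
  have := xys n; have := sM (mdist (x n) x0) (mdist_ge0 _ _); lra.
have hy := height_lip x0 (x n) (y n).
have hx : mdist (x n) x0 = height x0 (x n) - 1 by rewrite /height; lra.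
have hx0 := height_gt0 x0 (x n).
have ah : 0 < a * height x0 (x n) by rewrite mulr_gt0.
have aqh : 0 < q * (a * height x0 (x n)) by rewrite mulr_gt0.
have E : q * height x0 (x n) = 4 * (a * height x0 (x n)) + 4 * (q * (a * height x0 (x n))).
  by rewrite -{1}aq; ring.
have d2 : mdist (x n) (y n) < 2 * (a * height x0 (x n)) by rewrite hx in dx; lra.
have d3 : q * mdist (x n) (y n) < 2 * (q * (a * height x0 (x n))).
  by rewrite mulrCA ltr_pM2l.
have d4 : q * height x0 (x n) <= q * height x0 (y n) + q * mdist (x n) (y n).
  by rewrite -mulrDr ler_pM2l.
rewrite minr_pMr ?(ltW q0) // lt_min; apply/andP; split; lra.
Qed.

End Sublinear.

(** * The corona *)

(** A nonempty space is pointed by any of its points, which gives access to the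
covering characterization of compactness for pointed spaces. *)
Lemma compact_finite_cover (T : topologicalType) (A : set T) :
  compact A -> cover_compact A.
Proof.
move=> cA; have [->|/set0P[a _]] := eqVneq A set0.
  by move=> I D f _ _; exists finmap.fset0.
pose pT : ptopologicalType := HB.pack T (isPointed.Build T a).
have : @cover_compact pT A by rewrite -(@compact_cover pT).
exact.
Qed.

Section Corona.
Context {R : realType} {X : metricType R} (x0 : X).
Context {hX : topologicalType} (j : X -> hX).
Hypothesis properX : proper_space X.
Hypothesis hXP : higson_sublinear_compactification x0 j.

Let cpt : compact [set: hX]. Proof. by have [[]] := hXP. Qed.
Let hsd : hausdorff_space hX. Proof. by have [[]] := hXP. Qed.

Lemma continuous_embedding : continuous j.
Proof.
have [[_ _ [_ jP] _] _] := hXP; apply/continuousP => B oB.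
by apply/jP; exists B.
Qed.

Lemma ext_of_lipschitz (L : R) (f : X -> R^o) :
  (forall x, 0 <= f x <= 1) ->
  (forall x y, `|f x - f y| <= L * ratio_dist x0 x y) ->
  exists2 g : hX -> R^o, continuous g & forall x, g (j x) = f x.
Proof.
move=> f01 /higson_sublinear_lipschitz fH; have [_ extP] := hXP.
apply/extP => //; first by case: fH.
exists 1; split=> // N N1 x _ /=; have /andP[f0 f1] := f01 x.
by rewrite ger0_norm // (le_trans f1) // ltW.
Qed.

Lemma slow_restriction (g : hX -> R^o) : continuous g -> slow x0 (g \o j).
Proof.
move=> gc; have [_ extP] := hXP.
have gjc : continuous (g \o j : X -> R^o).
  by move=> x; apply: continuous_comp; [exact: continuous_embedding | exact: gc].
apply: slow_of_higson_sublinear; apply/extP => //; last by exists g.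
have /compact_bounded[B [Breal HB]] : compact (g @` setT).
  by apply: continuous_compact => //; apply: continuous_subspaceT.
by exists B; split=> // N BN x _ /=; apply: (HB N BN); exists (j x).
Qed.

Lemma closed_ball_image r : closed (j @` [set x | mdist x x0 <= r]).
Proof.
apply: compact_closed => //; apply: continuous_compact.
  by apply: continuous_subspaceT; exact: continuous_embedding.
apply: properX.
  apply: (@preimage_closed _ R^o (fun x => mdist x x0) [set y | y <= r]).
    by move=> x _; apply: mdist_continuous.
  exact: (@closed_le R r).
exists (2 * r) => x y /=; have := metric_triangle x x0 y.
rewrite (metric_sym x0 y); lra.
Qed.

(** As X is locally compact, it is open in any compactification: an open set B
that traces the ball lies in the closure of its trace by density, hence in the
compact image of the closed ball, so B is contained in X. *)
Lemma open_ball_image r : open (j @` [set x | mdist x x0 < r]).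
Proof.
have [[_ _ [jinj jP] jdense] _] := hXP.
have [B oB Bball] : exists2 B, open B & j @^-1` B = [set x | mdist x x0 < r].
  apply/jP; apply: (@open_comp _ R^o (fun x => mdist x x0) [set y | y < r]).
    by move=> x _; apply: mdist_continuous.
  exact: open_lt.
suff <- : B = j @` [set x | mdist x x0 < r] by [].
apply/seteqP; split=> [z Bz|_ [x xr <-]]; last by rewrite -Bball in xr.
have Bcl : B `<=` j @` [set x | mdist x x0 <= r].
  move=> y By; apply: contrapT => ny.
  have [||y' [[By' ny'] [x _ xy]]] := jdense (B `&` ~` (j @` [set x | mdist x x0 <= r])).
  - by exists y.
  - by apply: openI => //; apply: closed_openC; exact: closed_ball_image.
  apply: ny'; exists x => //=; apply: ltW.
  by have : (j @^-1` B) x; [rewrite /= xy | rewrite Bball].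
have [x _ xz] := Bcl z Bz; exists x => //.
by have : (j @^-1` B) x; [rewrite /= xz | rewrite Bball].
Qed.

Lemma closed_corona : closed (~` range j).
Proof.
rewrite -openC setCK.
suff -> : range j = \bigcup_(n in @setT nat) (j @` [set x | mdist x x0 < n%:R]).
  by apply: bigcup_open => n _; exact: open_ball_image.
apply/seteqP; split=> [_ [x _ <-]|_ [n _ [x _ <-]]]; last by exists x.
by exists (Num.truncn (mdist x x0)).+1 => //; exists x => //=; exact: truncnS_gt.
Qed.

(** The complement of a neighborhood of the corona is a compact subset of X,
hence is covered by finitely many balls around the base point. *)
Lemma near_corona_far (P : hX -> Prop) :
  (forall q, ~ range j q -> \forall z \near q, P z) ->
  exists t, forall x, far x0 t x -> P (j x).
Proof.
move=> nearP; pose O := P°.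
have cO : compact (~` O).
  by apply: (subclosed_compact _ cpt) => //; apply: open_closedC; apply: open_interior.
have [||D _ cov] := compact_finite_cover cO (I := nat) (D := setT)
  (f := fun n => j @` [set x | mdist x x0 < n%:R]).
- by move=> n _; exact: open_ball_image.
- move=> z nOz; have [[x _ <-]|/nearP Pz] := pselect (range j z); last by case: nOz.
  by exists (Num.truncn (mdist x x0)).+1 => //; exists x => //=; exact: truncnS_gt.
exists (1 + (\sum_(i <- finmap.enum_fset D) i)%N%:R) => x fx; apply: contrapT => nPx.
have [|n nD [y yn yx]] := cov (j x); first by move=> /interior_subset.
have [[_ _ [jinj _] _] _] := hXP; rewrite -(jinj _ _ yx) in fx.
move: fx; rewrite /far /= /height lerD2l leNgt => /negP; apply.
rewrite (lt_le_trans yn) // ler_nat.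
by rewrite (big_rem n) //= leq_addr.
Qed.

(** Bounded parts of X have closed image, so by density every neighborhood of
a point of the corona meets the far part of X. *)
Lemma corona_near_far (q : hX) (P : hX -> Prop) (t : R) :
  ~ range j q -> (\forall z \near q, P z) -> exists2 x, far x0 t x & P (j x).
Proof.
move=> nq Pq; have [[_ _ _ jdense] _] := hXP.
have [||z [[Pz nz] [x _ xz]]] :=
  jdense (P° `&` ~` (j @` [set x | mdist x x0 <= t - 1])).
- by exists q; split=> // -[x _ xq]; apply: nq; exists x.
- apply: openI; first exact: open_interior.
  by apply: closed_openC; exact: closed_ball_image.
exists x; last by rewrite xz; exact: interior_subset.
rewrite /far /= leNgt; apply/negP => xt; apply: nz; exists x => //=.
by move: xt; rewrite /height; lra.
Qed.

Lemma point_bump (q : hX) (B : set hX) : open B -> B q ->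
  exists g : hX -> R^o, [/\ continuous g, forall z, 0 <= g z,
    forall z, 0 < g z -> B z & g q = 1].
Proof.
move=> oB Bq.
have nrm : normal_space hX by apply: compact_normal.
have := @normal_completely_regular R hX nrm (hausdorff_accessible hsd).
move=> /(_ q (~` B) (open_closedC oB) (fun nB => nB Bq)).
move=> /(@uniform_separatorP _ R)[f [fc f01 f0 f1]].
have fle z : 0 <= f z <= 1.
  have /f01 : range f (f z) by exists z.
  by rewrite /= in_itv.
exists (fun z => 1 - f z); split.
- by move=> z; apply: (@cvgB _ R^o); [exact: cvg_cst | exact: fc].
- by move=> z; have /andP[_] := fle z; rewrite subr_ge0.
- move=> z fz; apply: contrapT => nBz; move: fz.
  by rewrite (f1 (f z)) ?subrr ?ltxx //; exists z.
- by rewrite (f0 (f q)) ?subr0 //; exists q.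
Qed.

(** Functions subordinate to an open cover of the corona, indexed by the members
of the cover and defined on the whole compactification: separating functions
at finitely many points suffice by compactness, and those that belong to the
same member of the cover are added up. *)
Lemma corona_bumps (U : set (set (corona j))) :
  (forall A, U A -> open A) -> \bigcup_(A in U) A = setT ->
  exists g : set (corona j) -> hX -> R^o, [/\
    forall A, continuous (g A),
    forall A (q : corona j), 0 < g A (val q) -> A q &
    forall q : corona j, exists2 A, U A & 1 / 2 < g A (val q)].
Proof.
move=> Uop Ucov.
have /choice[F FP] : forall p : hX, exists F : set (corona j) * (hX -> R^o),
    [/\ continuous F.2, forall z, 0 <= F.2 z,
        forall q : corona j, 0 < F.2 (val q) -> F.1 q &
        ~ range j p -> U F.1 /\ F.2 p = 1].
  move=> p; have [pj|npj] := pselect (range j p).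
    exists (set0, fun=> 0); split=> //= [|q]; last by rewrite ltxx.
    by move=> z; exact: cvg_cst.
  have pj : p \in ~` range j by apply: mem_set.
  pose q : corona j := SigSub pj.
  have : (\bigcup_(A in U) A) q by rewrite Ucov.
  move=> [A UA Aq]; have [B oB BA] := Uop A UA.
  have [|g [gc g0 gB gp]] := @point_bump p B oB; first by rewrite -BA in Aq.
  exists (A, g); split=> //= r /gB; by rewrite -[A]BA.
have cK : compact (~` range j).
  by apply: (subclosed_compact _ cpt) => //; exact: closed_corona.
have [||D DK cov] := compact_finite_cover cK (I := hX) (D := ~` range j)
  (f := fun p => (F p).2 @^-1` [set y | 1 / 2 < y]).
- move=> p _; have [Fc _ _ _] := FP p.
  by apply: open_comp; [move=> ? _; exact: Fc | exact: open_gt].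
- move=> p np; exists p => //=; have [_ _ _ /(_ np)[_ ->]] := FP p; lra.
exists (fun A z => \sum_(p <- finmap.enum_fset D | (F p).1 == A) (F p).2 z); split.
- move=> A; apply: (@continuous_big R^o) => [|p _]; first exact: add_continuous.
  by have [] := FP p.
- move=> A q gq; have : exists2 p, (F p).1 = A & 0 < (F p).2 (val q).
    apply: contrapT => nex; move: gq; rewrite big1_seq ?ltxx // => p /andP[/eqP FA _].
    apply/eqP; rewrite eq_le; apply/andP; split; last by have [_ + _ _] := FP p; apply.
    by rewrite leNgt; apply/negP => Fp; apply: nex; exists p.
  by move=> [p <-]; have [_ _ + _] := FP p; apply.
- move=> q; have [|p pD /= Fpq] := cov (val q); first exact: set_mem (valP q).
  have /DK /set_mem np := pD; have [_ F0 _ /(_ np)[UFp _]] := FP p.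
  exists (F p).1 => //; apply: (lt_le_trans Fpq).
  rewrite (big_rem p) //= eqxx lerDl; apply: sumr_ge0 => r _.
  by have [_ + _ _] := FP r; apply.
Qed.

End Corona.

(** * Counting and finite families *)

Section Finite.

Lemma near_seq (T : Type) (I : eqType) (F : set_system T) (s : seq I)
    (P : I -> T -> Prop) : Filter F ->
  (forall i, i \in s -> \forall z \near F, P i z) ->
  \forall z \near F, forall i, i \in s -> P i z.
Proof.
move=> FF; elim: s => [|i s IHs] Ps; first by apply: nearW.
have := Ps i (mem_head _ _).
have /IHs : forall k, k \in s -> \forall z \near F, P k z.
  by move=> k ks; apply: Ps; rewrite in_cons ks orbT.
apply: filterS2 => z Psz Piz k; rewrite in_cons => /orP[/eqP->//|]; exact: Psz.
Qed.

Lemma count_lt (I : eqType) (s : seq I) (a b : pred I) i :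
  subpred a b -> i \in s -> b i -> ~~ a i -> (count a s < count b s)%N.
Proof.
move=> ab; elim: s => //= k s IHs; rewrite in_cons => /orP[/eqP<-|ks] bi ai.
  by rewrite bi (negbTE ai) add0n add1n ltnS sub_count.
have lt_s := IHs ks bi ai; rewrite -addnS; apply: leq_add => //.
by case E: (a k) => //; rewrite (ab k E).
Qed.

(** The values that exceed h 0 are at most N in number and one of them exceeds
h N, so at most N - 1 of them are left for the N intervals ]h k, h k.+1]. *)
Lemma empty_gap (R : realType) (I : eqType) (s : seq I) (v : I -> R) N
    (h : nat -> R) : (forall k, h k <= h k.+1) ->
  (count (fun i => (h 0%N < v i)%R) s <= N)%N -> (exists2 i, i \in s & h N < v i) ->
  exists k : 'I_N, forall i, i \in s -> h k < v i -> h k.+1 < v i.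
Proof.
elim: N h => [|N IHN] h hh cnt [i si hi].
  by move: cnt; rewrite leqNgt -has_count => /hasPn/(_ i si); rewrite hi.
have [nogap|] := pselect (forall i, i \in s -> h 0%N < v i -> h 1%N < v i).
  by exists ord0.
move=> /existsNP[k /not_implyP[sk /not_implyP[hk /negP nhk]]].
have cnt1 : (count (fun i => (h 1%N < v i)%R) s <= N)%N.
  rewrite -ltnS; apply: leq_trans cnt.
  by apply: (count_lt _ sk) => // m; apply: le_lt_trans.
have [|l lP] := IHN (h \o S) (fun k => hh k.+1) cnt1; first by exists i.
by exists (lift ord0 l).
Qed.

Lemma count_le_card (I : choiceType) (s : seq I) (a : I -> Prop) N : uniq s ->
  [set i | i \in s /\ a i] #<= `I_N -> (count (fun i => `[< a i >]) s <= N)%N.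
Proof.
case: s => [//|i0 s']; set s := i0 :: s' => us aN.
pose f := [seq i <- s | `[< a i >]].
rewrite -size_filter -card_le_II -/f; apply: card_le_trans aN.
have injf : {in `I_(size f) &, injective (nth i0 f)}.
  move=> m n; rewrite !inE => mf nf /eqP.
  by rewrite nth_uniq ?filter_uniq // => /eqP.
have := inj_card_eq injf; rewrite card_eq_le => /andP[_ /card_le_trans]; apply.
apply: subset_card_le => _ [m /= mf <-].
by have := mem_nth i0 mf; rewrite mem_filter => /andP[/asboolP].
Qed.

End Finite.

Section SlowFamily.
Context {R : realType} {X : metricType R} (x0 : X).

Lemma slow_seq (I : eqType) (s : seq I) (f : I -> X -> R) e : 0 < e ->
  (forall i, slow x0 (f i)) ->
  exists2 de, 0 < de & exists t, forall i, i \in s -> forall x y,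
    far x0 t x -> far x0 t y -> ratio_dist x0 x y < de -> `|f i x - f i y| < e.
Proof.
move=> e0 fs; elim: s => [|i s [d1 d10 [t1 H1]]].
  by exists 1 => //; exists 0.
have [d2 d20 [t2 H2]] := fs i e e0.
exists (Num.min d1 d2); first by rewrite lt_min d10.
exists (Num.max t1 t2) => k; rewrite in_cons => ks x y; rewrite /far /=.
rewrite !ge_max lt_min => /andP[x1 x2] /andP[y1 y2] /andP[D1 D2].
by move: ks => /orP[/eqP->|ks]; [apply: H2 | apply: H1].
Qed.

End SlowFamily.

(** * The dimension of the corona is at most that of the space *)

Section Dimension.
Context {R : realType} {X : metricType R} (x0 : X).
Context {hX : topologicalType} (j : X -> hX).
Hypothesis properX : proper_space X.
Hypothesis hXP : higson_sublinear_compactification x0 j.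

Let D := ratio_dist x0.
Let Dpm : pseudometric_fun D := ratio_pseudometric x0.

Lemma tent_extension (W : set X) (eta : R) : 0 < eta ->
  exists2 g : hX -> R^o, continuous g & forall x, g (j x) = tent D W eta x.
Proof.
move=> eta0; apply: (ext_of_lipschitz hXP (L := eta^-1)).
  by move=> x; rewrite tent_ge0 // tent_le1.
exact: tent_lip.
Qed.

Let in_corona (q : corona j) : ~ range j (val q).
Proof. exact: set_mem (valP q). Qed.

Lemma open_corona_pos (g : hX -> R^o) : continuous g ->
  open [set q : corona j | 0 < g (val q)].
Proof.
move=> gc; exists (g @^-1` [set y | 0 < y]) => //.
by apply: open_comp; [move=> ? _; exact: gc | exact: open_gt].
Qed.

(** The pieces of the coloring are chosen so small that each lies where a
function [g A] subordinate to the given cover is large.  The set [W i A] is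
made of the pieces of color i assigned to A; tents of width below half the gap
over [W i A] and [W i A'] have disjoint supports, and this passes to the
corona, so the positivity sets of the extended tents have multiplicity at most
n + 1. *)
Lemma covdim_le_of_controlled n :
  controlled n (far x0) (fun=> D) -> covdim_le (corona j) n.
Proof.
move=> con U /finite_seqP[s Us] Uop Ucov.
have [g [gc gU gcov]] := corona_bumps properX hXP Uop Ucov.
have [t1 far1] : exists t, forall x, far x0 t x ->
    exists2 A, A \in s & 1 / 2 < g A (j x).
  apply: (near_corona_far properX hXP
    (P := fun z => exists2 A, A \in s & 1 / 2 < g A z)) => q nq.
  have [A UA Aq] := gcov (SigSub (mem_set nq : q \in ~` range j)).
  have : \forall z \near q, 1 / 2 < g A z by apply: cvgr_gt Aq; exact: gc.
  by apply: filterS => z Az; exists A => //; rewrite Us in UA.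
have [|d0 d00 [t2 far2]] := @slow_seq R X x0 _ s (fun A => g A \o j) (1 / 4) _
  (fun A => slow_restriction hXP (gc A)); first lra.
have [|d d_gt0 [t3 col]] := con (d0 / 4); first lra.
pose t := Num.max t1 (Num.max t2 t3).
have [tt1 tt2 tt3] : [/\ t1 <= t, t2 <= t & t3 <= t].
  by rewrite /t !le_max !lexx !orbT.
have [c [l [near_eq eq_small]]] := col t tt3.
have farW t' x : t' <= t -> far x0 t x -> far x0 t' x by exact: le_trans.
(* The member A assigned to a piece must depend on the piece alone, hence the
   choice of a representative point in it. *)
pose rep i L : X := xget x0 [set x | [/\ far x0 t x, c x = i & l x = L]].
have repP x : far x0 t x ->
    [/\ far x0 t (rep (c x) (l x)), c (rep (c x) (l x)) = c x &
        l (rep (c x) (l x)) = l x].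
  move=> fx; have /= := @xgetI _ x0
    [set y | [/\ far x0 t y, c y = c x & l y = l x]] x (And3 fx erefl erefl).
  exact.
have /choice[a aP] : forall x, exists A, far x0 t x ->
    A \in s /\ 1 / 2 < g A (j x).
  move=> x; have [fx|nfx] := pselect (far x0 t x); last by exists set0.
  by have [A sA gA] := far1 x (farW _ _ tt1 fx); exists A.
pose W i A := [set x | [/\ far x0 t x, c x = i & a (rep (c x) (l x)) = A]].
pose eta := Num.min (d / 2) (d0 / 4).
have [etad etad0] : eta <= d / 2 /\ eta <= d0 / 4.
  by rewrite /eta !ge_min !lexx orbT.
have eta0 : 0 < eta by rewrite /eta lt_min; apply/andP; split; lra.
have /choice[psi psiP] : forall p : 'I_n.+1 * set (corona j),
    exists psi : hX -> R^o, continuous psi /\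
      forall x, psi (j x) = tent D (W p.1 p.2) eta x.
  move=> p; have [psi psic psij] := tent_extension (W p.1 p.2) eta0.
  by exists psi.
have [_ Dsym Dtri] := Dpm.
have tentW p x : 0 < psi p (j x) ->
    exists2 w, W p.1 p.2 w & D x w < eta.
  by have [_ ->] := psiP p; apply: tent_gt0.
(* The tent over W i A is supported where g A stays large; on the corona this
   puts its positivity set inside A. *)
have psi_g i A x : far x0 t x -> 0 < psi (i, A) (j x) -> 1 / 4 < g A (j x).
  move=> fx /tentW[w /= [fw cw aw] xw]; have [fr cr lr] := repP w fw.
  have [sA gA] := aP _ fr; rewrite aw in sA gA.
  have wr := eq_small _ _ fw fr (esym cr) (esym lr).
  have xr : D x (rep (c w) (l w)) < d0 by have := Dtri x w (rep (c w) (l w)); lra.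
  have := far2 A sA _ _ (farW _ _ tt2 fx) (farW _ _ tt2 fr) xr.
  by rewrite ltr_norml /=; lra.
have psi_disj i A A' x : 0 < psi (i, A) (j x) -> 0 < psi (i, A') (j x) -> A = A'.
  move=> /tentW[w /= [fw cw aw] xw] /tentW[w' /= [fw' cw' aw'] xw'].
  have cc : c w = c w' by rewrite cw.
  have lw : l w = l w'.
    by apply: near_eq => //; have := Dtri w x w'; rewrite (Dsym w x) /D in xw xw' *; lra.
  by rewrite -aw -aw' cc lw.
pose B p := [set q : corona j | 0 < psi p (val q)].
exists (B @` ([set: 'I_n.+1] `*` U)); split.
- apply: finite_image; apply: finite_setX; first exact: finite_finset.
  by apply/finite_seqP; exists s.
- by move=> _ [p _ <-]; apply: open_corona_pos; have [] := psiP p.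
- apply/seteqP; split=> // q _; apply: contrapT => nq.
  have small p : p \in [seq (i, A) | i <- enum 'I_n.+1, A <- s] ->
      \forall z \near val q, psi p z < 1.
    move=> /allpairsP[[i A] /= [_ sA ->]].
    have [psic _] := psiP (i, A); apply: cvgr_lt; first exact: psic.
    apply: le_lt_trans ltr01; rewrite leNgt; apply/negP => pq; apply: nq.
    by exists (B (i, A)) => //; exists (i, A) => //; split=> //=; rewrite Us.
  have [x fx xP] := corona_near_far properX hXP t (@in_corona q) (near_seq _ small).
  have [fr _ _] := repP x fx; have [sA _] := aP _ fr.
  pose p := (c x, a (rep (c x) (l x))).
  have psi1 : psi p (j x) = 1 by have [_ ->] := psiP p; apply: tent1.
  have : psi p (j x) < 1 by apply: xP; apply: allpairs_f; rewrite ?mem_enum.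
  by rewrite psi1 ltxx.
- move=> _ [[i A] [_ /= UA] <-]; exists A => // q Bq; apply: gU.
  rewrite ltNge; apply/negP => gq.
  have n1 : \forall z \near val q, g A z < 1 / 4.
    by apply: cvgr_lt; [exact: gc | lra].
  have n2 : \forall z \near val q, 0 < psi (i, A) z.
    by apply: cvgr_gt Bq; have [+ _] := psiP (i, A); apply.
  have [x fx [gx px]] := corona_near_far properX hXP t (@in_corona q) (filterI n1 n2).
  by have := psi_g _ _ _ fx px; rewrite ltNge (ltW gx).
- move=> q; have Bdisj i A A' : B (i, A) q -> B (i, A') q -> A = A'.
    move=> Bq Bq'; have n1 : \forall z \near val q, 0 < psi (i, A) z.
      by apply: cvgr_gt Bq; have [+ _] := psiP (i, A); apply.
    have n2 : \forall z \near val q, 0 < psi (i, A') z.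
      by apply: cvgr_gt Bq'; have [+ _] := psiP (i, A'); apply.
    have [x fx [px px']] := corona_near_far properX hXP t (@in_corona q) (filterI n1 n2).
    exact: psi_disj px px'.
  (* By disjointness within a color, a point of the corona lies in at most one
     positivity set of each color. *)
  pose Bof (k : nat) := B (inord k, xget set0 [set A | B (inord k, A) q]).
  apply: card_le_trans (card_image_le Bof `I_n.+1).
  apply: subset_card_le => _ [[[i A] _ <-] Bq].
  exists (nat_of_ord i); rewrite /= ?ltn_ord // /Bof inord_val.
  have Bx := xgetI (P := [set A | B (i, A) q]) set0 Bq.
  by congr (B (_, _)); apply: Bdisj Bx Bq.
Qed.

End Dimension.

(** * The dimension of the space is at most that of the corona *)

Section Refine.
Context {R : realType} {X : metricType R} (x0 : X).
Context {hX : topologicalType} (j : X -> hX).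
Hypothesis properX : proper_space X.
Hypothesis hXP : higson_sublinear_compactification x0 j.

Let D := ratio_dist x0.
Let Dpm : pseudometric_fun D := ratio_pseudometric x0.
Let in_corona (q : corona j) : ~ range j (val q).
Proof. exact: set_mem (valP q). Qed.

(** The functions subordinate to the refined cover vary slowly in D, so two
nearby points whose values both miss the interval ]h k, h k.+1] have the same
set of functions above it.  This set is the first part of the label; it
determines a color class of the m-dimensional coloring, close to the point,
and the label there is the second part. *)
Lemma controlled_of_covdim_le n m :
  controlled m (far x0) (fun=> D) -> covdim_le (corona j) n ->
  controlled n (far x0) (fun=> D).
Proof.
move=> conm cov ep ep0; have [_ Dsym Dtri] := Dpm.
have [|d d0 [t0 colm]] := conm (ep / 2); first lra.
have [c [l [near_eq eq_small]]] := colm t0 (lexx _).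
pose eta := Num.min (d / 4) (ep / 4).
have [etad etaep] : eta <= d / 4 /\ eta <= ep / 4.
  by rewrite /eta !ge_min !lexx orbT.
have eta0 : 0 < eta by rewrite /eta lt_min; apply/andP; split; lra.
pose Y i := [set x | far x0 t0 x /\ c x = i].
have /choice[psi psiP] : forall i, exists psi : hX -> R^o, continuous psi /\
    forall x, psi (j x) = tent D (Y i) eta x.
  by move=> i; have [psi ? ?] := tent_extension hXP (Y i) eta0; exists psi.
pose O i := [set q : corona j | 0 < psi i (val q)].
have [||| V [/finite_seqP[s0 Vs0] Vop Vcov VO Vmult]] := cov (range O).
- by apply: finite_image; exact: finite_finset.
- by move=> _ [i _ <-]; apply: open_corona_pos; have [] := psiP i.
- apply/seteqP; split=> // q _; apply: contrapT => nq.
  have small i : i \in enum 'I_m.+1 -> \forall z \near val q, psi i z < 1.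
    move=> _; apply: cvgr_lt; first by have [+ _] := psiP i; apply.
    apply: le_lt_trans ltr01; rewrite leNgt; apply/negP => pq; apply: nq.
    by exists (O i) => //; exists i.
  have [x fx xP] := corona_near_far properX hXP t0 (@in_corona q) (near_seq _ small).
  have psi1 : psi (c x) (j x) = 1 by have [_ ->] := psiP (c x); apply: tent1.
  by have := xP (c x) (mem_enum _ _); rewrite psi1 ltxx.
pose s := undup s0; have us : uniq s by exact: undup_uniq.
have Vs : V = [set` s] by rewrite Vs0; apply/seteqP; split=> B /=; rewrite mem_undup.
have [g [gc gV gcov]] := corona_bumps properX hXP Vop Vcov.
have /choice[a aP] : forall B : set (corona j), exists i : 'I_m.+1, V B -> B `<=` O i.
  move=> B; have [VB|nVB] := pselect (V B); last by exists ord0.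
  by have [_ [i _ <-] Bi] := VO B VB; exists i.
(* The n + 2 thresholds h 0, ..., h n.+1 are equally spaced by w in ]0, 1/2],
   so that h n.+1 = 1/2 is exceeded by some g B near the corona. *)
pose w : R := (2 * n.+2%:R)^-1.
have w0 : 0 < w by rewrite invr_gt0 mulr_gt0 // ltr0n.
pose h k : R := k.+1%:R * w.
have hS k : h k.+1 = h k + w by rewrite /h -natr1 mulrDl mul1r.
have h0 k : 0 < h k by rewrite mulr_gt0 // ltr0n.
have hn : h n.+1 = 1 / 2.
  by rewrite /h /w invfM mulrCA divff ?pnatr_eq0 // mulr1 div1r.
pose P z := [/\ (count (fun B => (h 0%N < g B z)%R) s <= n.+1)%N,
  exists2 B, B \in s & h n.+1 < g B z &
  forall B, B \in s -> h 0%N < g B z -> 0 < psi (a B) z].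
have [t1 far1] : exists t, forall x, far x0 t x -> P (j x).
  apply: (near_corona_far properX hXP (P := P)) => q0 nq.
  pose q : corona j := SigSub (mem_set nq : q0 \in ~` range j).
  have [A VA Aq] := gcov q.
  have nA : \forall z \near q0, 1 / 2 < g A z by apply: cvgr_gt Aq; exact: gc.
  have out B : B \in s -> \forall z \near q0, h 0%N < g B z -> B q.
    move=> sB; have [Bq|nBq] := pselect (B q); first exact: nearW.
    have : \forall z \near q0, g B z < h 0%N.
      apply: cvgr_lt; first exact: gc.
      apply: le_lt_trans (h0 0%N); rewrite leNgt; apply/negP => gq.
      by apply: nBq; apply: gV.
    by apply: filterS => z /lt_trans H /H; rewrite ltxx.
  have pos B : B \in s -> \forall z \near q0, h 0%N < g B z -> 0 < psi (a B) z.
    move=> sB; have VB : V B by rewrite Vs.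
    have [Bq|nBq] := pselect (B q).
      have : 0 < psi (a B) q0 by exact: (aP B VB q Bq).
      move=> pq; have : \forall z \near q0, 0 < psi (a B) z.
        by apply: cvgr_gt pq; have [+ _] := psiP (a B); apply.
      by apply: filterS => z.
    by have := out B sB; apply: filterS => z H /H.
  apply: filterS (filterI nA (filterI (near_seq _ pos) (near_seq _ out))).
  move=> z [Az [posz outz]]; split=> //.
    have := Vmult q; rewrite Vs => /(count_le_card (a := fun B => B q) us).
    apply: leq_trans.
    rewrite -!size_filter; apply: uniq_leq_size; first exact: filter_uniq.
    move=> B; rewrite !mem_filter => /andP[hB sB]; rewrite sB andbT.
    by apply/asboolP; apply: outz.
  by exists A; rewrite ?hn //; move: VA; rewrite Vs.
have [|d1 d10 [t2 far2]] := @slow_seq R X x0 _ s (fun A => g A \o j) w _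
  (fun A => slow_restriction hXP (gc A)); first exact: w0.
exists (Num.min d1 (d / 2)); first by rewrite lt_min d10 /=; lra.
exists (Num.max t1 t2) => t; rewrite ge_max => /andP[tt1 tt2].
have farW t' x : t' <= t -> far x0 t x -> far x0 t' x by exact: le_trans.
have /choice[k kP] : forall x, exists k : 'I_n.+1, far x0 t x ->
    forall B, B \in s -> h k < g B (j x) -> h k.+1 < g B (j x).
  move=> x; have [fx|nfx] := pselect (far x0 t x); last by exists ord0.
  have [cnt top _] := far1 x (farW _ _ tt1 fx).
  have hle i : h i <= h i.+1 by rewrite hS lerDl ltW.
  by have [k kP] := empty_gap hle cnt top; exists k.
(* By the choice of k x, the functions in S x are in fact above h (k x).+1. *)
pose S x := [set B | B \in s /\ h (k x) < g B (j x)].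
pose ind (Q : set (set (corona j))) := a (xget set0 Q).
have /choice[y yP] : forall x, exists y, far x0 t x ->
    [/\ far x0 t0 y, c y = ind (S x) & D x y < eta].
  move=> x; have [fx|nfx] := pselect (far x0 t x); last by exists x.
  have [_ [B sB hB] pos] := far1 x (farW _ _ tt1 fx).
  have hmono : h (k x) <= h n.+1.
    by rewrite ler_pM2r // ler_nat ltnS ltnW // ltn_ord.
  have [sB' hB'] := xgetI (P := S x) set0 (conj sB (le_lt_trans hmono hB)).
  have : 0 < psi (ind (S x)) (j x).
    apply: pos => //; apply: le_lt_trans hB'.
    by rewrite ler_pM2r // ler_nat.
  have [_ ->] := psiP (ind (S x)) => tent0.
  have [z [fz cz] xz] : exists2 z, Y (ind (S x)) z & D x z < eta.
    exact: tent_gt0 tent0.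
  by exists z.
apply: (@colored_of_labels _ n _ _ _ _ _ _ k (fun x => (S x, l (y x)))).
  move=> x x' fx fx' kk; rewrite lt_min => /andP[Dd1 Dd].
  (* A function of S z exceeds h (k z).+1 at z, and it varies by less than
     w = h (k z).+1 - h (k z) between z and z'. *)
  have half z z' : far x0 t z -> far x0 t z' -> k z = k z' -> D z z' < d1 ->
      S z `<=` S z'.
    move=> fz fz' kz zz B [sB hB]; split=> //.
    have := kP z fz B sB hB; rewrite hS kz.
    have := far2 B sB _ _ (farW _ _ tt2 fz) (farW _ _ tt2 fz') zz.
    by rewrite ltr_norml /=; lra.
  have SS : S x = S x'.
    apply/seteqP; split; first exact: half.
    by apply: half => //; rewrite Dsym.
  congr pair => //; have [fy cy xy] := yP x fx; have [fy' cy' xy'] := yP x' fx'.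
  apply: near_eq; rewrite // ?cy ?cy' ?SS //.
  have := Dtri (y x) x (y x'); have := Dtri x x' (y x').
  rewrite (Dsym (y x) x) -/D in xy xy' Dd *; lra.
move=> x x' fx fx' _ [SS ll].
have [fy cy xy] := yP x fx; have [fy' cy' xy'] := yP x' fx'.
have cc : c (y x) = c (y x') by rewrite cy cy' SS.
have := eq_small _ _ fy fy' cc ll.
have := Dtri x (y x) x'; have := Dtri (y x) (y x') x'.
rewrite (Dsym (y x') x') -/D in xy xy' *; lra.
Qed.

End Refine.

Theorem corollary5p3 (R : realType) (X : metricType R) (x0 : X) (M : R)
    (hX : topologicalType) (j : X -> hX) :
  proper_space X -> cocompact X -> 0 < M -> scale_connected X M ->
  higson_sublinear_compactification x0 j ->
  asdimAN X <> None ->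
  asdimAN X = covdim (corona j).
Proof.
move=> properX cocoX M0 connX hXP finX.
have [m asm] : exists m, asdimAN_le X m.
  by apply: contra_notP finX => nm; apply/leastPN => m asm; apply: nm; exists m.
rewrite /asdimAN /covdim; congr least; apply/seteqP; split=> n.
  move=> /(controlled_of_asdimAN_le x0); exact: covdim_le_of_controlled.
move=> covn; apply: (asdimAN_le_of_controlled (x0 := x0) cocoX M0 connX asm).
apply: controlled_of_covdim_le covn => //.
exact: controlled_of_asdimAN_le asm.
Qed.
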